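(* Let $q\in\mathbb{C}$ with $|q|<1$, let $b\in\mathbb{C}$, and let $m$ be a non-negative integer. Let $D_q$ act on functions of the variable $x$. Then \[ \mathrm{H}_{n}(bD_{q})\{x^m\}= \begin{cases} x^m, & \text{if } n=0;\\[2pt] \Phi_{m}^{(q^n)}(b,x|q)=\displaystyle\sum_{k=0}^{m}\genfrac{[}{]}{0pt}{}{m}{k}_{q}(q^n;q)_{k}\,b^kx^{m-k}, & \text{if } n \text{ is an integer with } n\geq 1;\\[6pt] \mathrm{r}_{m}(b,x|q), & \text{if } n=\infty . \end{cases} \]
   Context: For $a\in\mathbb{C}$ and integers $n\ge 0$, $(a;q)_n=\prod_{k=0}^{n-1}(1-q^k a)$. The $q$-binomial coefficient is $\genfrac{[}{]}{0pt}{}{n}{k}_q=\frac{(q;q)_n}{(q;q)_k(q;q)_{n-k}}$. The $q$-differential operator is $D_q f(x)=\frac{f(x)-f(qx)}{x}$ (at $x=0$ the value is understood as the limit), and $D_q^k$ is its $k$-fold iterate, with $D_q^0$ the identity. For an integer $n\ge 0$, the $n$-th Heine binomial operator is \[ \mathrm{H}_n(bD_q)=\sum_{k=0}^{\infty}\frac{(q^n;q)_k}{(q;q)_k}(bD_q)^k,\qquad \mathrm{H}_n(bD_q)\{f(x)\}=\sum_{k=0}^\infty \frac{(q^n;q)_k}{(q;q)_k}b^kD_q^k f(x). \] For $n=\infty$, $\mathrm{H}_\infty(bD_q)$ denotes the limit operator, $\mathrm{H}_\infty(bD_q)\{f(x)\}=\lim_{n\to\infty}\mathrm{H}_n(bD_q)\{f(x)\}$.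 The homogeneous Hahn polynomials are $\Phi_{m}^{(\alpha)}(x,y|q)=\sum_{k=0}^{m}\genfrac{[}{]}{0pt}{}{m}{k}_{q}(\alpha;q)_{k}x^ky^{m-k}$, and $\mathrm{r}_m(b,x|q)=\sum_{k=0}^{m}\genfrac{[}{]}{0pt}{}{m}{k}_{q}b^kx^{m-k}$. *)

(* Defs.v *)
From mathcomp Require Export all_boot all_order all_algebra complex.
From mathcomp Require Export all_classical all_reals all_analysis.

Set Implicit Arguments.
Unset Strict Implicit.
Unset Printing Implicit Defensive.

Import Order.TTheory GRing.Theory Num.Theory.
Import numFieldNormedType.Exports.

Local Open Scope classical_set_scope.
Local Open Scope ring_scope.

(* [R[i]] carries no canonical topology, but every [numFieldType] variable      *)
(* does. The analytic notions are therefore defined over an arbitrary           *)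
(* [K : numFieldType]; instantiated at [R[i]], the topology is the one of the   *)
(* modulus, i.e. the usual topology of the complex plane.                       *)

Definition qpoch (K : numFieldType) (a q : K) (n : nat) : K :=
  \prod_(k < n) (1 - q ^+ k * a).

Definition qbinom (K : numFieldType) (q : K) (n k : nat) : K :=
  qpoch q q n / (qpoch q q k * qpoch q q (n - k)).

Definition qquot (K : numFieldType) (q : K) (f : K -> K) (x : K) : K :=
  (f x - f (q * x)) / x.

(* [0^'] is the punctured neighbourhood filter, so the (junk) value of [qquot]  *)
(* at 0 plays no role. [lim] is total; existence of the limit is [qdiff_ok].    *)
Definition qdiff (K : numFieldType) (q : K) (f : K -> K) (x : K) : K :=
  if x == 0 then lim (qquot q f t @[t --> (0 : K)^']) else qquot q f x.

Definition qdiff_ok (K : numFieldType) (q : K) (f : K -> K) : Prop :=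
  cvg (qquot q f t @[t --> (0 : K)^']).

Definition qdiff_iter (K : numFieldType) (q : K) (k : nat) (f : K -> K) :
    K -> K :=
  iter k (qdiff q) f.

Definition heine_term (K : numFieldType) (q b : K) (n : nat) (f : K -> K)
    (x : K) (k : nat) : K :=
  qpoch (q ^+ n) q k / qpoch q q k * b ^+ k * qdiff_iter q k f x.

(* Sum of the series, as the (total) limit of its partial sums; existence of    *)
(* the sum is [heine_ok].                                                       *)
Definition heine (K : numFieldType) (q b : K) (n : nat) (f : K -> K) (x : K) :
    K :=
  limn (series (heine_term q b n f x)).

Definition heine_ok (K : numFieldType) (q b : K) (n : nat) (f : K -> K)
    (x : K) : Prop :=
  (forall k, qdiff_ok q (qdiff_iter q k f)) /\
  cvgn (series (heine_term q b n f x)).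

(* The limit of operators is taken pointwise in the argument of [f].            *)
Definition heine_infty (K : numFieldType) (q b : K) (f : K -> K) (x : K) : K :=
  limn (fun n => heine q b n f x).

Definition heine_infty_ok (K : numFieldType) (q b : K) (f : K -> K) (x : K) :
    Prop :=
  (forall n, heine_ok q b n f x) /\ cvgn (fun n => heine q b n f x).

Definition hahn (K : numFieldType) (q : K) (m : nat) (alpha x y : K) : K :=
  \sum_(k < m.+1) qbinom q m k * qpoch alpha q k * x ^+ k * y ^+ (m - k).

Definition rpoly (K : numFieldType) (q : K) (m : nat) (b x : K) : K :=
  \sum_(k < m.+1) qbinom q m k * b ^+ k * x ^+ (m - k).

(* Main.v *)
Require Import Defs.

Import Order.TTheory GRing.Theory Num.Theory.
Import numFieldNormedType.Exports.

Local Open Scope ring_scope.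
Local Open Scope complex_scope.

(** On monomials [D_q] acts by [D_q x^m = (1 - q^m) x^(m-1)], so
    [D_q^k x^m / (q;q)_k] is the [q]-binomial coefficient times [x^(m-k)] and
    vanishes for [k > m]: the Heine series is a finite sum. For [n = 0] only the
    term [k = 0] survives since [(1;q)_k = 0] for [k > 0], and for [n] tending to
    infinity [(q^n;q)_k] tends to [1] termwise. *)

Section QCalculus.
Local Open Scope classical_set_scope.
Local Set Implicit Arguments.
Local Unset Strict Implicit.
Variables (K : numFieldType) (q b : K).

(* For [m = 0] the truncated exponent [m.-1] is harmless: [1 - q ^+ 0 = 0]. *)
Lemma qquot_scaled_monomial (c : K) m t : t != 0 ->
  qquot q (fun t : K => c * t ^+ m) t = c * (1 - q ^+ m) * t ^+ m.-1.
Proof.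
move=> t0; rewrite /qquot; case: m => [|m] /=.
  by rewrite !expr0 !subrr mulr0 mul0r mul0r.
rewrite exprMn -mulrBr -{1}[t ^+ m.+1]mul1r -mulrBl [t ^+ _]exprSr.
by rewrite !mulrA mulfK.
Qed.

(** Off 0 the quotient agrees with a polynomial, which is continuous. This limit supplies both the
    value of [qdiff] at 0 and the existence claim [qdiff_ok]. *)
Lemma cvg_qquot_scaled_monomial (c : K) m :
  qquot q (fun t : K => c * t ^+ m) t @[t --> (0 : K)^'] -->
    c * (1 - q ^+ m) * 0 ^+ m.-1.
Proof.
have cont : (c * (1 - q ^+ m) * t ^+ m.-1) @[t --> (0 : K)^'] -->
    c * (1 - q ^+ m) * 0 ^+ m.-1.
  apply: cvgM; first exact: cvg_cst.
  apply: cvg_within_filter; elim: m.-1 => [|k IHk]; first exact: cvg_cst.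
  by under eq_fun do rewrite exprS; rewrite exprS; exact: cvgM.
apply: cvg_trans cont; apply: near_eq_cvg.
near=> t; apply/esym; apply: qquot_scaled_monomial.
by near: t; exact: nbhs_dnbhs_neq.
Unshelve. all: by end_near.
Qed.

(** The scalar [c] makes the family of functions stable under [qdiff], so that iterates follow by
    induction. *)
Lemma qdiff_scaled_monomial (c : K) m :
  qdiff q (fun t : K => c * t ^+ m) =
  (fun t : K => c * (1 - q ^+ m) * t ^+ m.-1).
Proof.
apply/funext => x; rewrite /qdiff; case: eqVneq => [->|x0].
  apply: cvg_lim; first exact: norm_hausdorff.
  exact: cvg_qquot_scaled_monomial.
exact: qquot_scaled_monomial.
Qed.

Lemma qdiff_iter_monomial k m :
  qdiff_iter q k (fun t : K => t ^+ m) =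
  (fun t : K => (\prod_(i < k) (1 - q ^+ (m - i))) * t ^+ (m - k)).
Proof.
rewrite /qdiff_iter; elim: k => [|k IHk] /=.
  by apply/funext => t; rewrite big_ord0 mul1r subn0.
by rewrite IHk qdiff_scaled_monomial big_ord_recr /= subnS.
Qed.

Lemma qdiff_ok_iter_monomial k m :
  qdiff_ok q (qdiff_iter q k (fun t : K => t ^+ m)).
Proof.
rewrite qdiff_iter_monomial.
by apply/cvg_ex; eexists; exact: cvg_qquot_scaled_monomial.
Qed.

Lemma qpoch1 k : qpoch 1 q k.+1 = 0 :> K.
Proof. by rewrite /qpoch big_ord_recl expr0 mulr1 subrr mul0r. Qed.

Lemma qpochS (a : K) k : qpoch a q k.+1 = qpoch a q k * (1 - q ^+ k * a).
Proof. by rewrite /qpoch big_ord_recr. Qed.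

Lemma hahn1 m (x : K) : hahn q m 1 b x = x ^+ m * qbinom q m 0.
Proof.
rewrite /hahn big_ord_recl big1 ?addr0 => [|i _].
  by rewrite /qpoch big_ord0 expr0 subn0 !mulr1 mulrC.
by rewrite lift0 qpoch1 mulr0 !mul0r.
Qed.

Section Contraction.
Hypothesis hq : `|q| < 1.

(** A vanishing factor would make a positive power of [q] equal to 1, against [hq]. *)
Lemma qpoch_neq0 k : qpoch q q k != 0.
Proof.
elim: k => [|k IHk]; first by rewrite /qpoch big_ord0 oner_neq0.
rewrite qpochS mulf_neq0 // -exprSr subr_eq0; apply/eqP => q1.
have : `|q| ^+ k.+1 < 1 by rewrite exprn_ilt1.
by rewrite -normrX -q1 normr1 ltxx.
Qed.

Lemma qbinom0 m : qbinom q m 0 = 1.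
Proof. by rewrite /qbinom subn0 {2}/qpoch big_ord0 mul1r divff ?qpoch_neq0. Qed.

(** The product consists of the top [k] factors of [qpoch q q m], in descending order; the other
    factors form [qpoch q q (m - k)]. *)
Lemma prod_qbinom m k : (k <= m)%N ->
  \prod_(i < k) (1 - q ^+ (m - i)) / qpoch q q k = qbinom q m k.
Proof.
move=> km; rewrite /qbinom.
suff -> : qpoch q q m = \prod_(i < k) (1 - q ^+ (m - i)) * qpoch q q (m - k).
  by rewrite -mulf_div divff ?qpoch_neq0 // mulr1.
elim: k km => [|k IHk] km; first by rewrite big_ord0 mul1r subn0.
rewrite IHk ?(ltnW km) // big_ord_recr /= -mulrA; congr (_ * _).
by rewrite -(subnSK km) qpochS -exprSr mulrC.
Qed.

Lemma heine_term_monomial n m k (x : K) : (k <= m)%N ->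
  heine_term q b n (fun t : K => t ^+ m) x k =
  qbinom q m k * qpoch (q ^+ n) q k * b ^+ k * x ^+ (m - k).
Proof.
move=> km; rewrite /heine_term qdiff_iter_monomial -prod_qbinom // !mulrA.
by rewrite [_ * \prod_(_ < _) _]mulrC !mulrA [_ * qpoch _ _ _ / _]mulrAC.
Qed.

Lemma heine_term_monomial_eq0 n m k (x : K) : (m < k)%N ->
  heine_term q b n (fun t : K => t ^+ m) x k = 0.
Proof.
(* [Ordinal mk] is the index [m], whose factor is [1 - q ^+ 0 = 0]. *)
move=> mk; rewrite /heine_term qdiff_iter_monomial (bigD1 (Ordinal mk)) //=.
by rewrite subnn expr0 subrr !mul0r mulr0.
Qed.

Lemma cvg_heine_monomial n m (x : K) :
  series (heine_term q b n (fun t : K => t ^+ m) x) @ \oo -->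
  hahn q m (q ^+ n) b x.
Proof.
(* The [N]-th partial sum runs over indices below [N], so it is constant from [N = m.+1] on. *)
apply: cvg_near_cst; exists m.+1 => // N /= mN.
rewrite /series /= (big_cat_nat (n := m.+1)) //=.
rewrite [X in _ + X]big_nat_cond [X in _ + X]big1.
  by rewrite addr0 big_mkord; apply: eq_bigr => i _;
     apply: heine_term_monomial; rewrite -ltnS.
by move=> i /andP[/andP[mi _] _]; exact: heine_term_monomial_eq0.
Qed.

Lemma heine_monomial n m (x : K) :
  heine q b n (fun t : K => t ^+ m) x = hahn q m (q ^+ n) b x.
Proof.
by apply: cvg_lim; [exact: norm_hausdorff|exact: cvg_heine_monomial].
Qed.

Lemma heine_ok_monomial n m (x : K) :
  heine_ok q b n (fun t : K => t ^+ m) x.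
Proof.
split=> [k|]; first exact: qdiff_ok_iter_monomial.
by apply/cvg_ex; eexists; exact: cvg_heine_monomial.
Qed.

Hypothesis cvg_q : q ^+ n @[n --> \oo] --> (0 : K).

Lemma cvg_qpoch k : qpoch (q ^+ n) q k @[n --> \oo] --> (1 : K).
Proof.
elim: k => [|k IHk].
  by under eq_fun do rewrite /qpoch big_ord0; exact: cvg_cst.
under eq_fun do rewrite qpochS.
have : 1 - q ^+ k * q ^+ n @[n --> \oo] --> 1 - q ^+ k * 0.
  by apply: cvgB; [exact: cvg_cst|apply: cvgM => //; exact: cvg_cst].
by rewrite mulr0 subr0 => /(cvgM IHk); rewrite mulr1.
Qed.

(** The range of summation does not depend on [n], so the limit is taken term by term. *)
Lemma cvg_hahn m (x : K) :
  hahn q m (q ^+ n) b x @[n --> \oo] --> rpoly q m b x.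
Proof.
rewrite /hahn /rpoly; apply: cvg_big => [|k _]; first exact: add_continuous.
do 2 (apply: cvgM; last exact: cvg_cst).
have := cvgM (cvg_cst (qbinom q m k)) (cvg_qpoch k).
by rewrite mulr1; apply.
Qed.

Lemma cvg_heine_infty m (x : K) :
  heine q b n (fun t : K => t ^+ m) x @[n --> \oo] --> rpoly q m b x.
Proof. by under eq_fun do rewrite heine_monomial; exact: cvg_hahn. Qed.

End Contraction.
End QCalculus.

(** This discharges [cvg_q], which can fail over a non-archimedean [K] even when [hq] holds. The
    claim reduces to powers of the real modulus [r]. *)
Lemma cvg_expr_complex (R : realType) (q : R[i]) : `|q| < 1 ->
  (((q : (R[i] : numFieldType)) ^+ n) @[n --> \oo] -->
    (0 : (R[i] : numFieldType)))%classic.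
Proof.
rewrite normc_def -[1]/(1%:C) ltcR; set r := Num.sqrt _ => r1.
have r0 : 0 <= r by exact: sqrtr_ge0.
have /cvgrPdist_lt cvgr : (r ^+ n @[n --> \oo] --> 0)%classic.
  by apply: cvg_expr; rewrite ger0_norm.
(* A positive element of [R[i]] has zero imaginary part, so its real part serves as the real
   tolerance. *)
apply/cvgrPdist_lt => e; rewrite ltcE => /andP[/eqP Ime Ree].
apply: filterS (cvgr _ Ree) => n.
rewrite !sub0r !normrN ger0_norm ?exprn_ge0 // => rn.
by rewrite normrX normc_def -/r -rmorphXn ltcE /= Ime eqxx.
Qed.

Theorem theorem1 (R : realType) (q b : R[i]) (m : nat) (hq : `|q| < 1) :
  (forall x : R[i],
     heine_ok q b 0 (fun t : R[i] => t ^+ m) x /\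
     heine q b 0 (fun t : R[i] => t ^+ m) x = x ^+ m) /\
  (forall (n : nat) (x : R[i]), (1 <= n)%N ->
     heine_ok q b n (fun t : R[i] => t ^+ m) x /\
     heine q b n (fun t : R[i] => t ^+ m) x = hahn q m (q ^+ n) b x /\
     hahn q m (q ^+ n) b x =
       \sum_(k < m.+1)
          qbinom q m k * qpoch (q ^+ n) q k * b ^+ k * x ^+ (m - k)) /\
  (forall x : R[i],
     heine_infty_ok q b (fun t : R[i] => t ^+ m) x /\
     heine_infty q b (fun t : R[i] => t ^+ m) x = rpoly q m b x).
Proof.
split=> [x|]; last split=> [n x _|x].
- split; first exact: heine_ok_monomial.
  (* Here the Hahn parameter is [q ^+ 0 = 1]. *)
  by rewrite heine_monomial // expr0 hahn1 qbinom0 // mulr1.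
- split; first exact: heine_ok_monomial.
  by split; first exact: heine_monomial.
- have cvgH := @cvg_heine_infty _ q b hq (cvg_expr_complex _ _ hq) m x.
  split; last by apply: cvg_lim; [exact: norm_hausdorff|exact: cvgH].
  split=> [n|]; first exact: heine_ok_monomial.
  by apply/cvg_ex; eexists; exact: cvgH.
Qed.
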